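(* Let $q\ge 7$. Then in the closure order $\preceq$ on $\mathbf W(q-2,2)$ the following relations hold: (1) for integers $j,i$ with $4\le j<q/2$ and $1\le i\le j-3$: $\gamma_{j+1,\,q+1-j+i}\preceq\gamma_{j,\,q+3-j+i}$; (2) for integers $j,i$ with $q/2+2<j\le q-1$ and $1\le i<j-q/2-1$: $\gamma_{q-j,\,j+1-i}\preceq\gamma_{q+2-j,\,j-i}$.
   Context: Permutations in $\mathfrak S_q$ are composed right to left; $(i,\dots,u)$ is the cycle $i\mapsto i+1\mapsto\cdots\mapsto u\mapsto i$. $\mathfrak S_q$ is a Coxeter group with simple reflections $s_i=(i,i+1)$, length $\ell$ = number of inversions, and Bruhat order $\le$ (the standard Bruhat order: $w'\le w$ iff there is a chain $w'=v_0,\dots,v_m=w$ with $\ell(v_{i-1})\le\ell(v_i)$ and each $v_{i-1}^{-1}v_i$ a reflection). For $1\le u<v\le q$ let $\gamma_{u,v}=(2,3,\ldots,v)(1,2,\ldots,u)$; the set $\mathbf W(q-2,2)=\{\gamma_{u,v}:1\le u<v\le q\}$ is the set of minimal-length representatives of $W_J\backslash\mathfrak S_q$, where $J=\{s_1,\dots,s_{q-1}\}\setminus\{s_2\}$ and $W_J=\langle J\rangle$. Let $w_{0,J}$ be the longest element of $W_J$, i.e. the permutation swapping $1$ and $2$ and sending $x\mapsto q+3-x$ for $3\le x\le q$. The closure order on $\mathbf W(q-2,2)$ is defined by: $w\preceq w'$ iff there exists $h\in W_J$ with $$h\,w\,w_{0,J}\,h^{-1}\,w_{0,J}\le w'$$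 in the Bruhat order of $\mathfrak S_q$. *)

(* Defs.v *)
From mathcomp Require Import all_boot all_fingroup.

Set Implicit Arguments.
Unset Strict Implicit.
Unset Printing Implicit Defensive.

Local Open Scope group_scope.

(* The letter a in {1, ..., q} is represented by the ordinal x : 'I_q of value
   a.-1, so a letter is x.+1. All parameters named i, u, v below are letters. *)

(* Product of permutations composed right to left, (s ** t) x = s (t x);
   the group law of {perm _} composes left to right. *)
Notation "s ** t" := (t * s) (at level 40, left associativity) : group_scope.

Definition letters (q i u : nat) : seq 'I_q :=
  [seq x : 'I_q <- enum 'I_q | (i <= x.+1 <= u)%N].

Lemma letters_uniq q i u : uniq (letters q i u).
Proof. exact/filter_uniq/enum_uniq. Qed.

(* The cycle (i, i+1, ..., u); the identity when u <= i. *)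
Definition cyc (q i u : nat) : 'S_q :=
  perm (can_inj (prev_next (letters_uniq q i u))).

Definition sref (q i : nat) : 'S_q := cyc q i i.+1.

(* The index i : 'I_q with 0 < i ranges over 1, ..., q-1. *)
Definition simple_refls (q : nat) : {set 'S_q} :=
  [set sref q i | i : 'I_q & (0 < i)%N].

(* In a Coxeter group, the conjugates of the simple reflections. *)
Definition reflections (q : nat) : {set 'S_q} :=
  class_support (simple_refls q) [set: 'S_q].

Definition ell (q : nat) (w : 'S_q) : nat :=
  #|[set p : 'I_q * 'I_q | (p.1 < p.2)%N && (w p.2 < w p.1)%N]|.

Definition bruhat_step (q : nat) : rel 'S_q :=
  fun v w => (ell v <= ell w)%N && (v^-1 ** w \in reflections q).

Definition bruhat_le (q : nat) : rel 'S_q := connect (@bruhat_step q).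

Definition gamma (q u v : nat) : 'S_q := cyc q 2 v ** cyc q 1 u.

Definition Wset (q : nat) : {set 'S_q} :=
  [set w | [exists u : 'I_q.+1, exists v : 'I_q.+1,
     (0 < u < v)%N && (w == gamma q u v)]].

Definition WJ (q : nat) : {group 'S_q} := <<simple_refls q :\ sref q 2>>%G.

(* In letters: 1 and 2 are swapped, and x |-> q+3-x for 3 <= x <= q. The
   default value of insubd is used only for q = 1. *)
Definition w0J_fun (q : nat) (x : 'I_q) : 'I_q :=
  insubd x (if (x < 2)%N then 1 - x else q + 1 - x)%N.

Lemma w0J_fun_inj q : injective (@w0J_fun q).
Proof.
suff K: involutive (@w0J_fun q) by exact: can_inj K.
move=> [x xq]; apply: val_inj; rewrite /w0J_fun !val_insubd /=.
case: (ltnP x 2) => [|x2].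
  case: x xq => [|[|//]] xq _; last by rewrite subnn (ltnW xq) /= subn0 xq.
  by rewrite /= subn0; case: (ltnP 1 q) => q1 /=; rewrite ?subnn ?xq // ltnNge q1.
have xq1 : (x <= q + 1)%N by rewrite addn1 ltnW // ltnW.
have h : (q + 1 - x < q)%N by rewrite ltn_subLR // addnC ltn_add2r.
have h2 : (q + 1 - x < 2)%N = false.
  by rewrite ltn_subLR // addn1 addn2 !ltnS leqNgt xq.
by rewrite h h2 subKn // xq.
Qed.

Definition w0J (q : nat) : 'S_q := perm (@w0J_fun_inj q).

(* A relation on Wset q, hence the two membership conditions. *)
Definition closure_le (q : nat) (w w' : 'S_q) : Prop :=
  [/\ w \in Wset q, w' \in Wset q &
    exists2 h : 'S_q, h \in WJ q &
      bruhat_le (h ** w ** w0J q ** h^-1 ** w0J q) w'].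

(* Main.v *)
(* Write w0 for w_{0,J}. Since w0 is an involution, x = h w w0 h^-1 w0 means that
   x w0 and w w0 are conjugate under W_J. In each of the two families w' is
   longer than w by one, so a single Bruhat step x = w' t with a transposition
   t has to suffice. The permutation w w0 is piecewise a reflection; apart from
   its 2-cycles and fixed points in the middle, it moves letters along two paths
   that start at 1 and 2 and end at 1 or 2. Multiplying w' w0 by a suitable t
   merges a middle 2-cycle into the path that ends at 2 (first family), or
   splits one off the path that ends at 1 (second family), which gives the cycle
   structure of w w0; following the cycles yields h as a product of two cycles
   of consecutive letters. *)

Require Import Defs.
From mathcomp Require Import all_boot all_fingroup.
From mathcomp Require Import zify.

(* The functions below act on values of ordinals (letters minus one), with
   letters as parameters, except that [a] and [b] in [tperm_val] are values.
   Each test is a single strict inequality, because [lia] branches on negated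
   conjunctions and equalities. *)
Definition cyc_val (i u x : nat) : nat :=
  if x.+1 < i then x else if x.+1 < u then x.+1 else if x < u then i.-1 else x.

Definition cycV_val (i u x : nat) : nat :=
  if x.+1 < i then x else if x < i then u.-1 else if x < u then x.-1 else x.

Definition gamma_val (u v x : nat) : nat :=
  if x.+1 < u then x.+2 else if x < u then 0
  else if x.+1 < v then x.+1 else if x < v then 1 else x.

Definition w0J_val (q x : nat) : nat := if x < 2 then 1 - x else q + 1 - x.

Definition tperm_val (a b x : nat) : nat :=
  if x < a then x else if x < a.+1 then b
  else if x < b then x else if x < b.+1 then a else x.

(* Evaluates innermost applications first, dropping the branches that the
   hypotheses exclude. *)
Ltac eval_val t :=
  let z := fresh "z" in let E := fresh "E" in
  remember t as z eqn:E;
  rewrite /w0J_val /gamma_val /cyc_val /cycV_val /tperm_val in E;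
  repeat match type of E with
  | _ = (if ?a < ?b then _ else _) =>
      let C := fresh "C" in
      move: E; case: (ltnP a b) => C E; try (exfalso; clear E; lia)
  end.

Ltac eval_vals :=
  repeat match goal with
  | |- context [w0J_val ?q ?x] => is_var x; eval_val (w0J_val q x)
  | |- context [gamma_val ?u ?v ?x] => is_var x; eval_val (gamma_val u v x)
  | |- context [cyc_val ?i ?u ?x] => is_var x; eval_val (cyc_val i u x)
  | |- context [cycV_val ?i ?u ?x] => is_var x; eval_val (cycV_val i u x)
  | |- context [tperm_val ?a ?b ?x] => is_var x; eval_val (tperm_val a b x)
  end.

Ltac lia_ifs := repeat (case: ifP => ?); intros; lia.

(** * Values of the permutations *)

Lemma val_letters (q i u : nat) : 0 < i -> u <= q ->
  map val (letters q i u) = iota i.-1 (u - i.-1).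
Proof.
move=> i0 uq; rewrite /letters.
rewrite -(filter_map val (fun n => i <= n.+1 <= u)) val_enum_ord.
apply: (irr_sorted_eq ltn_trans ltnn).
- exact/(sorted_filter ltn_trans)/iota_ltn_sorted.
- exact: iota_ltn_sorted.
by move=> x; rewrite mem_filter !mem_iota; apply/idP/idP; lia.
Qed.

Lemma val_cyc (q i u : nat) (x : 'I_q) : 0 < i -> u <= q ->
  cyc q i u x = cyc_val i u x :> nat.
Proof.
move=> i0 uq; rewrite -[LHS]/(val _) /cyc permE.
rewrite -(next_map val_inj (letters_uniq q i u)) val_letters // next_nth mem_iota.
rewrite /cyc_val /=; move: (nat_of_ord x) => n.
case: ifP => [xin|xout]; last by lia_ifs.
have -> : u - i.-1 = (u - i).+1 by lia.
have {1 2}-> : n = nth 0 (iota i.-1 (u - i).+1) (n - i.-1).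
  by rewrite nth_iota; lia.
rewrite index_uniq ?size_iota ?iota_uniq //; last by lia.
rewrite /=; case: (ltnP (n - i.-1) (u - i)) => h.
  by rewrite nth_iota //; lia_ifs.
(* At the last letter [nth] returns its default, the head of the list in [next_nth], so the cycle
   closes up at i. *)
by rewrite nth_default ?size_iota //; lia_ifs.
Qed.

Lemma val_cycV (q i u : nat) (x : 'I_q) : 0 < i <= u -> u <= q ->
  (cyc q i u)^-1%g x = cycV_val i u x :> nat.
Proof.
move=> iu uq; rewrite -{2}(permKV (cyc q i u) x) val_cyc //; last by lia.
by move: (nat_of_ord _) => n; eval_vals; lia.
Qed.

Lemma val_gamma (q u v : nat) (x : 'I_q) : 0 < u < v -> v <= q ->
  gamma q u v x = gamma_val u v x :> nat.
Proof.
move=> uv vq; rewrite /gamma permM !val_cyc //; last by lia.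
by move: (nat_of_ord x) => n; eval_vals; lia.
Qed.

Lemma gamma_in_Wset (q u v : nat) : 0 < u < v -> v <= q ->
  gamma q u v \in Wset q.
Proof.
move=> uv vq; rewrite inE.
have uq : u < q.+1 by lia.
have vq1 : v < q.+1 by lia.
apply/existsP; exists (Ordinal uq); apply/existsP; exists (Ordinal vq1).
by rewrite /= uv eqxx.
Qed.

Lemma val_w0J (q : nat) (x : 'I_q) : 1 < q ->
  w0J q x = w0J_val q x :> nat.
Proof.
move=> q1; rewrite -[LHS]/(val _) permE /w0J_fun val_insubd -/(w0J_val q x).
suff -> : w0J_val q x < q by [].
by have := ltn_ord x; rewrite /w0J_val; lia_ifs.
Qed.

Lemma w0JK (q : nat) : 1 < q -> (w0J q * w0J q = 1)%g.
Proof.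
move=> q1; apply/permP => x; apply: val_inj => /=.
rewrite permM perm1 !val_w0J //.
by move: (nat_of_ord x) (ltn_ord x) => n nq; eval_vals; lia.
Qed.

Lemma val_tperm (q : nat) (a b x : 'I_q) :
  a < b -> tperm a b x = tperm_val a b x :> nat.
Proof.
move=> ab.
have -> : tperm a b x =
    (if x == a :> nat then val b else if x == b :> nat then val a else val x)
    :> nat.
  have valE (c : 'I_q) : (x == c :> nat) = (x == c) by [].
  rewrite !valE; case: tpermP => [->|->|/eqP/negbTE-> /eqP/negbTE-> //].
    by rewrite eqxx.
  by rewrite eqxx; case: eqP => // ->.
by rewrite /tperm_val /=; lia_ifs.
Qed.

(** * Reflections, length and Bruhat steps *)

Lemma sref_tperm (q : nat) (a b : 'I_q) : b = a.+1 :> nat ->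
  sref q b = tperm a b.
Proof.
move=> ab; apply/permP => x; apply: val_inj => /=.
have ba := ltn_ord b; rewrite val_cyc ?val_tperm ?ab //; try lia.
by rewrite /cyc_val /tperm_val; lia_ifs.
Qed.

Lemma tperm_reflection (q : nat) (a b : 'I_q) : a != b ->
  tperm a b \in reflections q.
Proof.
move=> ab.
have q1 : 1 < q.
  by have := ltn_ord a; have := ltn_ord b; move: ab; rewrite -val_eqE /=; lia.
pose x0 := Ordinal (ltnW q1); pose x1 := Ordinal q1.
pose c := tperm x0 a x1.
have ca : c != a by rewrite -[X in _ != X](tpermL x0 a) (inj_eq perm_inj).
(* The first factor sends [x0] to [a] and [x1] to [c]; the second fixes [a] and sends [c] to [b]. *)
pose p := (tperm x0 a * tperm c b)%g.
have -> : tperm a b = (tperm x0 x1 ^ p)%g.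
  rewrite tpermJ !permM tpermL -/c tpermL tpermD //; first by rewrite eq_sym.
apply: imset2_f; last by rewrite inE.
apply/imsetP; exists x1; rewrite ?inE //.
by rewrite -(sref_tperm q x0 x1).
Qed.

(* Involution on pairs that carries the inversions of [w t] injectively to
   inversions of [w]: apply [t] to both entries unless that reverses them. *)
Lemma ell_tperm (q : nat) (w : 'S_q) (a b : 'I_q) : a < b -> w b < w a ->
  ell (tperm a b * w)%g <= ell w.
Proof.
move=> ab wab; pose t := tperm a b.
pose f (p : 'I_q * 'I_q) := if t p.1 < t p.2 then (t p.1, t p.2) else p.
have fK : {in [pred p : 'I_q * 'I_q | p.1 < p.2], cancel f f}.
  move=> [c d] cd; rewrite inE /= in cd.
  by rewrite /f /=; case E: (t c < t d); rewrite /= ?E // !tpermK cd.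
rewrite /ell -(card_in_imset (f := f)); last first.
  move=> x y; rewrite !inE => /andP[hx _] /andP[hy _] e.
  by rewrite -(fK x) ?inE // e fK.
apply: subset_leq_card; apply/subsetP => z /imsetP[[c d]].
rewrite inE /= => /andP[cd]; rewrite !permM -/t => inv {z}->; rewrite inE /f /=.
case: ifP => /= [->//|]; rewrite cd /=.
move: cd inv; rewrite /t; case: tpermP => [->|->|_ _]; case: tpermP => [->|->|_ _];
  move: ab wab; lia.
Qed.

(** The pointwise identity is h w w0 = w' t w0 h with t = (a b), so h w w0 h^-1 w0 collapses to w'
    t, one Bruhat step below w'. *)
Lemma closure_le_tperm (q : nat) (w w' h : 'S_q) (a b : 'I_q) : 1 < q ->
  w \in Wset q -> w' \in Wset q -> h \in WJ q -> a < b -> w' b < w' a ->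
  (forall y, h (w (w0J q y)) = w' (tperm a b (w0J q (h y)))) ->
  closure_le w w'.
Proof.
move=> q1 wW w'W hJ ab inv E; split=> //; exists h => //.
have {}E : (w0J q * (w * h) = h * (w0J q * (tperm a b * w')))%g.
  by apply/permP => y; rewrite !permM.
rewrite E mulKg mulgA w0JK // mul1g; apply: connect1.
rewrite /bruhat_step ell_tperm //= invMg mulgA mulgV mul1g tpermV.
by apply: tperm_reflection; rewrite -val_eqE /=; lia.
Qed.

(** * Cycles in W_J *)

Lemma sref_in_WJ (q i : nat) : 2 < i < q -> sref q i \in WJ q.
Proof.
move=> /andP[i2 iq]; apply: mem_gen; rewrite !inE; apply/andP; split.
  have q1 : 1 < q by lia.
  (* Letter 2 separates the two: s_2 moves it, s_i with i > 2 fixes it. *)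
  apply/eqP => /(congr1 (fun s : 'S_q => nat_of_ord (s (Ordinal q1)))).
  by rewrite !val_cyc /cyc_val /=; try lia; case: ifP => ?; try case: ifP; lia.
by apply/imsetP; exists (Ordinal iq); rewrite ?inE //=; lia.
Qed.

Lemma cyc_id (q i u : nat) : 0 < i -> u <= q -> u <= i -> cyc q i u = 1%g.
Proof.
move=> i0 uq ui; apply/permP => x; apply: val_inj => /=.
by rewrite perm1 val_cyc // /cyc_val; lia_ifs.
Qed.

Lemma cycS (q i u : nat) : 0 < i <= u -> u < q ->
  cyc q i u.+1 = (sref q u * cyc q i u)%g.
Proof.
move=> iu uq; apply/permP => x; apply: val_inj => /=.
rewrite permM !val_cyc; try lia.
by move: (nat_of_ord x) => n; eval_vals; lia.
Qed.

Lemma cyc_in_WJ (q i u : nat) : 2 < i -> u <= q -> cyc q i u \in WJ q.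
Proof.
move=> i2; elim: u => [|u IHu] uq; first by rewrite cyc_id ?group1; lia.
have [ui|iu] := ltnP u i; first by rewrite cyc_id ?group1; lia.
rewrite cycS; try lia.
by apply: groupM; [apply: sref_in_WJ; lia | apply: IHu; lia].
Qed.

(** * The two families *)

Lemma closure_le_gamma1 (q j i : nat) : 4 <= j -> 2 * j < q ->
    1 <= i <= j - 3 ->
  closure_le (gamma q (j + 1) (q + 1 - j + i)) (gamma q j (q + 3 - j + i)).
Proof.
move=> j4 jq ij.
have aq : q - j < q by lia.
have bq : q + 2 - j + i < q by lia.
(* Swapping the letters q+1-j and q+3-j+i inserts the 2-cycle (j+2, q+2-j) of w' w0 between j-i and
   2. The witness h takes q+3-j+i, j+2-i, the last letters before 2 in w w0, to q+2-j, j+2. *)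
apply: (@closure_le_tperm q _ _
  ((cyc q (j + 2 - i) (j + 2))^-1 * cyc q (q + 2 - j) (q + 3 - j + i))%g
  (Ordinal aq) (Ordinal bq)).
- lia.
- by apply: gamma_in_Wset; lia.
- by apply: gamma_in_Wset; lia.
- by rewrite groupM ?groupV ?cyc_in_WJ //; lia.
- by rewrite /=; lia.
- by rewrite !val_gamma /gamma_val /=; lia_ifs.
move=> y; apply: val_inj => /=; have := ltn_ord y.
rewrite !(permM (_^-1)) val_cyc ?val_cycV ?val_gamma ?val_tperm ?val_w0J /=;
  try lia.
rewrite ?(val_cyc, val_cycV, val_w0J); try lia.
move: (nat_of_ord y) => {}y /= yq.
by clear aq bq; eval_vals; lia.
Qed.

Lemma closure_le_gamma2 (q k i : nat) : 1 <= k -> 1 <= i ->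
    2 * (k + i + 1) < q ->
  closure_le (gamma q k (q - k + 1 - i)) (gamma q (k + 2) (q - k - i)).
Proof.
move=> k1 i1 kiq.
have aq : k - 1 < q by lia.
have bq : k + 1 < q by lia.
(* Here k stands for q-j. Swapping the letters k and k+2 cuts k+2, q+1-k, the last letters before 1
   in w' w0, out as a 2-cycle; h takes the 2-cycle (k+3+i, q+1-k-i) of w w0 to it. *)
apply: (@closure_le_tperm q _ _
  ((cyc q (q + 1 - k - i) (q + 1 - k))^-1 * cyc q (k + 2) (k + 3 + i))%g
  (Ordinal aq) (Ordinal bq)).
- lia.
- by apply: gamma_in_Wset; lia.
- by apply: gamma_in_Wset; lia.
- by rewrite groupM ?groupV ?cyc_in_WJ //; lia.
- by rewrite /=; lia.
- by rewrite !val_gamma /gamma_val /=; lia_ifs.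
move=> y; apply: val_inj => /=; have := ltn_ord y.
rewrite !(permM (_^-1)) val_cyc ?val_cycV ?val_gamma ?val_tperm ?val_w0J /=;
  try lia.
rewrite ?(val_cyc, val_cycV, val_w0J); try lia.
move: (nat_of_ord y) => {}y /= yq.
by clear aq bq; eval_vals; lia.
Qed.

Theorem theorem3p17 (q : nat) (hq : 7 <= q) :
  (forall j i : nat,
      4 <= j -> 2 * j < q ->
      1 <= i -> i <= j - 3 ->
      closure_le (gamma q (j + 1) (q + 1 - j + i))
                 (gamma q j (q + 3 - j + i)))
  /\
  (forall j i : nat,
      q + 4 < 2 * j -> j <= q - 1 ->
      1 <= i -> 2 * i + q + 2 < 2 * j ->
      closure_le (gamma q (q - j) (j + 1 - i))
                 (gamma q (q + 2 - j) (j - i))).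
Proof.
split=> j i.
  by move=> j4 jq i1 ij; apply: closure_le_gamma1; rewrite ?i1.
move=> jq1 jq2 i1 ij.
have -> : j + 1 - i = q - (q - j) + 1 - i by lia.
have -> : q + 2 - j = q - j + 2 by lia.
have -> : j - i = q - (q - j) - i by lia.
by apply: closure_le_gamma2; lia.
Qed.
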